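(* Let $T>0$, $\alpha>0$, $\beta>0$, $\sigma>0$, $u_1>0$, let $N$ be a positive integer and $R_0\ge 0$, and consider the optimal control problem $$\int_0^T\big(\alpha R(t)+\beta u(t)\big)\,dt\to\inf,\qquad \dot R(t)=-u(t)R(t)+N\sigma^2,\qquad R(0)=R_0,\qquad 0\le u(t)\le u_1 .$$ Assume $\sqrt{\alpha N\sigma^2/\beta}>u_1$. Then the optimal control $\hat u$ has one of the following forms (which one depends on $R_0$ and $T$), for some $0<t_1<t_2<T$: (1.1) $\hat u(t)=0$ for $t\in(0,T)$; (1.2) $\hat u(t)=u_1$ for $t\in(0,t_1)$ and $\hat u(t)=0$ for $t\in(t_1,T)$; (1.3) $\hat u(t)=0$ for $t\in(0,t_1)$, $\hat u(t)=u_1$ for $t\in(t_1,t_2)$, and $\hat u(t)=0$ for $t\in(t_2,T)$. In particular, the optimal control only takes the values $0$ and $u_1$ and has at most two switchings.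
   Context: Admissible controls are functions $u\in L^\infty[0,T]$ with $0\le u(t)\le u_1$ for a.e. $t$ (identified up to a.e. equality); the corresponding state $R$ is the absolutely continuous solution of $\dot R=-uR+N\sigma^2$, $R(0)=R_0$. An optimal control is an admissible control minimizing the integral functional. *)

(* Defs.v *)
From HB Require Import structures.
From mathcomp Require Import all_boot all_order all_algebra.
From mathcomp Require Import all_classical all_reals all_analysis.
Set Implicit Arguments. Unset Strict Implicit. Unset Printing Implicit Defensive.
Import Order.TTheory GRing.Theory Num.Theory.
Import numFieldNormedType.Exports.
Local Open Scope classical_set_scope.
Local Open Scope ring_scope.

Section Defs.
Variable R : realType.
Local Notation mu := (@lebesgue_measure R).

Definition admissible (T u1 : R) (u : R -> R) : Prop :=
  measurable_fun `[0, T] u /\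
  {ae mu, forall t, `[0, T]%classic t -> 0 <= u t <= u1}.

(* x is the absolutely continuous solution on [0,T] of
   x' = - u x + N sigma^2, x(0) = R0, written in integral form *)
Definition is_state (T R0 sigma : R) (N : nat) (u x : R -> R) : Prop :=
  {within `[0, T]%classic, continuous x} /\
  mu.-integrable `[0, T]%classic (fun s => (- u s * x s + N%:R * sigma ^+ 2)%:E) /\
  forall t, 0 <= t <= T ->
    x t = R0 + Rintegral mu `[0, t]%classic (fun s => - u s * x s + N%:R * sigma ^+ 2).

Definition cost (T alpha beta : R) (u x : R -> R) : R :=
  Rintegral mu `[0, T]%classic (fun t => alpha * x t + beta * u t).

Definition optimal (T alpha beta sigma u1 R0 : R) (N : nat) (uh : R -> R) : Prop :=
  admissible T u1 uh /\
  exists xh, is_state T R0 sigma N uh xh /\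
    forall u x, admissible T u1 u -> is_state T R0 sigma N u x ->
      cost T alpha beta uh xh <= cost T alpha beta u x.
End Defs.

(* Main.v *)
(* The problem is bilinear in (control, state). If p is the adjoint of u,
   p' = u p - alpha with p(T) = 0, and x, y are the states of u, v, then exactly
     J(v) - J(u) = int_0^T (beta - p y) (v - u),
   and taking v = u + e (w - u), e -> 0, gives the first-order condition:
   almost everywhere u = u1 where phi := p x > beta and u = 0 where phi < beta.
   Moreover phi' = psi := c p - alpha x and psi' = u X - 2 alpha c, where
   c = N sigma^2 and X := alpha x + c p. If phi <= beta at an interior local
   minimum m, then psi(m) = 0, and near m we have psi' < 0: if phi(m) < beta
   because u = 0 there, and if phi(m) = beta because
   X(m)^2 = psi(m)^2 + 4 alpha c phi(m) = 4 alpha beta c while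
   u <= u1 < sqrt (alpha c / beta). So m is in fact a strict local maximum, a
   contradiction. Hence phi > beta strictly between any two points of
   {phi >= beta}: this set is an interval, which avoids T since phi(T) = 0.

   The calculus of absolutely continuous functions rests on one remark: for a
   bounded f, F is a primitive of f as soon as
   |F(t) - F(s) - int_s^t f| <= C (t - s)^2. *)
Require Import Defs.
From HB Require Import structures.
From mathcomp Require Import all_boot all_order all_algebra.
From mathcomp Require Import all_classical all_reals all_analysis.
From mathcomp Require Import measurable_realfun ring lra.
Import Order.TTheory GRing.Theory Num.Theory.
Import numFieldNormedType.Exports.
Local Open Scope classical_set_scope.
Local Open Scope ring_scope.

Local Notation "'\I_' ( s , t ) f" := (Rintegral (@lebesgue_measure _) `[s, t] f)
  (at level 10, f at level 9).

(** * Bounded measurable functions on [0, T] and their integrals *)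

Section Primitives.
Context {R : realType} (T : R).
Local Notation mu := (@lebesgue_measure R).
Implicit Types (f g F G : R -> R) (s t : R).

(** The bound holds at every point of [0, T], so sums, products and exponentials stay in the class
    by pointwise estimates; an essentially bounded control is first replaced by such a
    representative. *)
Definition bmf f := measurable_fun `[0, T] f /\
  exists M, forall t, 0 <= t <= T -> `|f t| <= M.

(* [prim F f]: on [0, T], F is Lipschitz with almost everywhere derivative f. *)
Definition prim F f := bmf f /\
  forall s t, 0 <= s -> s <= t -> t <= T -> F t - F s = \I_(s, t) f.

Lemma bmf_integrable f s t : bmf f -> 0 <= s -> t <= T ->
  mu.-integrable `[s, t] (EFin \o f).
Proof.
move=> [mf [M fM]] s0 tT.
have sub : `[s, t] `<=` `[0, T].
  by apply: subset_itv; rewrite bnd_simp.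
apply: measurable_bounded_integrable => //.
- by rewrite /= lebesgue_measure_itv/=; case: ifP => _; rewrite -?EFinB ltry.
- exact: measurable_funS mf.
- exists M; split; first exact: num_real.
  move=> x Mx y /sub /=; rewrite in_itv /= => yT.
  exact: le_trans (fM _ yT) (ltW Mx).
Qed.

Lemma bmf_eq f g : bmf f -> (forall t, 0 <= t <= T -> f t = g t) -> bmf g.
Proof.
move=> [mf [M fM]] fg; split.
  apply: eq_measurable_fun mf => x; rewrite inE /= in_itv /=; exact: fg.
by exists M => t tT; rewrite -fg// fM.
Qed.

Lemma bmf_cst c : bmf (fun=> c).
Proof. by split; [exact: measurable_cst | exists `|c|]. Qed.

Lemma bmfD f g : bmf f -> bmf g -> bmf (fun t => f t + g t).
Proof.
move=> [mf [M fM]] [mg [K gK]]; split; first exact: measurable_funD.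
exists (M + K) => t tT.
by rewrite (le_trans (ler_normD _ _)) // lerD ?fM ?gK.
Qed.

Lemma bmfM f g : bmf f -> bmf g -> bmf (fun t => f t * g t).
Proof.
move=> [mf [M fM]] [mg [K gK]]; split; first exact: measurable_funM.
by exists (M * K) => t tT; rewrite normrM ler_pM ?fM ?gK.
Qed.

Lemma bmfN f : bmf f -> bmf (fun t => - f t).
Proof.
move=> bf; apply: (bmf_eq (fun t => (-1) * f t)).
  by apply: bmfM => //; exact: bmf_cst.
by move=> t _; rewrite mulN1r.
Qed.

Lemma bmfB f g : bmf f -> bmf g -> bmf (fun t => f t - g t).
Proof. by move=> bf bg; apply: bmfD => //; exact: bmfN. Qed.

Lemma bmf_expR f : bmf f -> bmf (fun t => expR (f t)).
Proof.
move=> [mf [M fM]]; split.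
  exact: (measurableT_comp (@measurable_expR R) mf).
exists (expR M) => t tT; rewrite gtr0_norm ?expR_gt0// ler_expR.
by rewrite (le_trans (ler_norm _)) // fM.
Qed.

Lemma int_chasles f r s t : bmf f -> 0 <= r -> r <= s -> s <= t -> t <= T ->
  \I_(r, t) f = \I_(r, s) f + \I_(s, t) f.
Proof.
move=> bf r0 rs st tT.
apply/eqP; rewrite addrC -subr_eq; apply/eqP.
rewrite Rintegral_itvB ?bnd_simp//; last exact: bmf_integrable.
rewrite Rintegral_itv_obnd_cbnd//.
apply: integrableS (bmf_integrable f s t bf (le_trans r0 rs) tT) => //.
by apply: subset_itv; rewrite bnd_simp.
Qed.

Lemma int_cst c s t : s <= t -> \I_(s, t) (fun=> c) = c * (t - s).
Proof.
move=> st; rewrite Rintegral_cst//= lebesgue_measure_itv/= lte_fin.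
by move: st; rewrite le_eqVlt => /predU1P[->|->]//; rewrite ltxx subrr mulr0.
Qed.

Lemma eq_int f g s t : (forall x, s <= x <= t -> f x = g x) ->
  \I_(s, t) f = \I_(s, t) g.
Proof. by move=> fg; apply: eq_Rintegral => x; rewrite inE/= in_itv/= => /fg. Qed.

Lemma intD f g s t : bmf f -> bmf g -> 0 <= s -> t <= T ->
  \I_(s, t) (fun x => f x + g x) = \I_(s, t) f + \I_(s, t) g.
Proof. by move=> bf bg s0 tT; rewrite RintegralD//; exact: bmf_integrable. Qed.

Lemma intB f g s t : bmf f -> bmf g -> 0 <= s -> t <= T ->
  \I_(s, t) (fun x => f x - g x) = \I_(s, t) f - \I_(s, t) g.
Proof. by move=> bf bg s0 tT; rewrite RintegralB//; exact: bmf_integrable. Qed.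

Lemma intZ c f s t : bmf f -> 0 <= s -> t <= T ->
  \I_(s, t) (fun x => c * f x) = c * \I_(s, t) f.
Proof. by move=> bf s0 tT; rewrite RintegralZl//; exact: bmf_integrable. Qed.

Lemma le_int f g s t : bmf f -> bmf g -> 0 <= s -> t <= T ->
  (forall x, s <= x <= t -> f x <= g x) -> \I_(s, t) f <= \I_(s, t) g.
Proof.
move=> bf bg s0 tT fg.
apply: le_Rintegral => //; first exact: bmf_integrable.
exact: bmf_integrable.
Qed.

Lemma int_le f c s t : bmf f -> 0 <= s -> s <= t -> t <= T ->
  (forall x, s <= x <= t -> f x <= c) -> \I_(s, t) f <= c * (t - s).
Proof.
by move=> bf s0 st tT fc; rewrite -int_cst//; apply: le_int => //; exact: bmf_cst.
Qed.

Lemma int_norm_le f c s t : bmf f -> 0 <= s -> s <= t -> t <= T ->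
  (forall x, s <= x <= t -> `|f x| <= c) -> `|\I_(s, t) f| <= c * (t - s).
Proof.
move=> bf s0 st tT fc; rewrite ler_norml; apply/andP; split; last first.
  by apply: int_le => // x /fc /ler_normlP[].
rewrite lerNl -mulN1r -intZ//; apply: int_le => //.
  by apply: bmfM => //; exact: bmf_cst.
by move=> x /fc /ler_normlP[]; rewrite mulN1r.
Qed.

(** * Lipschitz primitives and the quadratic criterion for them *)

Lemma prim_cst c : prim (fun=> c) (fun=> 0).
Proof.
split=> [|s t s0 st tT]; first exact: bmf_cst.
by rewrite int_cst// mul0r subrr.
Qed.

Lemma prim_int f : bmf f -> prim (fun t => \I_(0, t) f) f.
Proof.
move=> bf; split=> // s t s0 st tT.
by rewrite (int_chasles _ 0 s t)// addrC addKr.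
Qed.

Lemma prim_eq F G f g : prim F f ->
  (forall t, 0 <= t <= T -> F t = G t) ->
  (forall t, 0 <= t <= T -> f t = g t) -> prim G g.
Proof.
move=> [bf Ff] FG fg; split; first exact: (bmf_eq f).
move=> s t s0 st tT.
rewrite -!FG ?Ff ?s0 ?(le_trans s0) ?(le_trans st)//.
apply: eq_int => x /andP[sx xt]; apply: fg.
by rewrite (le_trans s0) ?(le_trans xt).
Qed.

Lemma prim_lipschitz F f : prim F f -> exists2 L, 0 <= L &
  forall s t, 0 <= s <= T -> 0 <= t <= T -> `|F t - F s| <= L * `|t - s|.
Proof.
move=> [bf Ff]; have [_ [M fM]] := bf; exists `|M| => // s t.
wlog st : s t / s <= t.
  move=> H hs ht; have [/H->//|/ltW /H ts] := leP s t.
  by rewrite distrC [`|t - s|]distrC ts.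
move=> /andP[s0 sT] /andP[t0 tT]; rewrite Ff// (ger0_norm (x := t - s)) ?subr_ge0//.
apply: int_norm_le => // x /andP[sx xt]; rewrite (le_trans _ (ler_norm _))//.
by rewrite fM// (le_trans s0) ?(le_trans xt).
Qed.

Lemma prim_continuous F f : prim F f -> {within `[0, T], continuous F}.
Proof.
move=> /prim_lipschitz[L L0 FL]; apply/subspace_continuousP => x /=.
rewrite in_itv/= => xT; apply/cvgrPdist_lt => e e0.
apply/nbhs_ballP; exists (e / (L + 1)) => /=; first by rewrite divr_gt0// ltr_wpDl.
move=> y; rewrite /ball/= => xy; rewrite in_itv/= => yT.
apply: le_lt_trans (FL _ _ yT xT) _.
have {}xy : (L + 1) * `|x - y| < e by rewrite mulrC -ltr_pdivlMr// ltr_wpDl.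
by apply: le_lt_trans xy; rewrite ler_wpM2r// lerDl.
Qed.

Lemma prim_bmf F f : prim F f -> bmf F.
Proof.
move=> FF; split.
  apply: subspace_continuous_measurable_fun => //; exact: prim_continuous FF.
have [L L0 FL] := prim_lipschitz _ _ FF.
exists (`|F 0| + L * `|T|) => t /andP[t0 tT].
have T0 := le_trans t0 tT.
rewrite -[F t](subrKC (F 0)) (le_trans (ler_normD _ _))// lerD2l.
rewrite (le_trans (FL _ _ _ _)) ?lexx ?t0//.
by rewrite ler_wpM2l// subr0 !ger0_norm.
Qed.

(** Cutting [[s, t]] into [n] equal pieces bounds the increment by [n * C * ((t - s) / n)^2 = C * (t
    - s)^2 / n], which tends to 0. *)
Lemma quadratic_increment_constant G (C : R) :
  (forall s t, 0 <= s -> s <= t -> t <= T -> `|G t - G s| <= C * (t - s) ^+ 2) ->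
  forall s t, 0 <= s -> s <= t -> t <= T -> G t = G s.
Proof.
move=> GC s t s0 st tT; apply/eqP; rewrite -subr_eq0 -normr_le0 leNgt.
apply/negP => D0; set D := `|_| in D0.
have step (h : R) k : 0 <= h -> s + k%:R * h <= T ->
    `|G (s + k%:R * h) - G s| <= k%:R * (C * h ^+ 2).
  move=> h0; elim: k => [|k IH]; first by rewrite !mul0r addr0 subrr normr0.
  have kk : s + k%:R * h <= s + k.+1%:R * h by rewrite lerD2l ler_wpM2r// ler_nat.
  move=> kT; rewrite -(subrKA (G (s + k%:R * h))) (le_trans (ler_normD _ _))//.
  have -> : k.+1%:R * (C * h ^+ 2) = C * h ^+ 2 + k%:R * (C * h ^+ 2).
    by rewrite -natr1; ring.
  rewrite lerD// ?IH ?(le_trans kk)//.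
  rewrite (le_trans (GC _ _ _ kk kT))// ?addr_ge0 ?mulr_ge0//.
  by rewrite (_ : _ + _ - _ = h)//; rewrite -natr1; ring.
have H n : n.+1%:R * D <= C * (t - s) ^+ 2.
  have n0 : n.+1%:R != 0 :> R by rewrite pnatr_eq0.
  have := step ((t - s) / n.+1%:R) n.+1.
  rewrite (_ : n.+1%:R * ((t - s) / _) = t - s); last by field.
  rewrite subrKC divr_ge0 ?subr_ge0// => /(_ isT tT) DC.
  rewrite mulrC -ler_pdivlMr ?ltr0n// (le_trans DC)//.
  by rewrite le_eqVlt (_ : _ == _)//; apply/eqP; field.
pose n := Num.bound `|C * (t - s) ^+ 2 / D|.
have := H n; rewrite leNgt => /negP; apply.
rewrite -ltr_pdivrMr//; apply: le_lt_trans (ler_norm _) _.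
apply: lt_le_trans (archi_boundP (normr_ge0 _)) _.
by rewrite ler_nat.
Qed.

(** [F] minus the indefinite integral of [f] has increments of quadratic size, hence is constant. *)
Lemma prim_of_quadratic F f (C : R) : bmf f ->
  (forall s t, 0 <= s -> s <= t -> t <= T ->
    `|F t - F s - \I_(s, t) f| <= C * (t - s) ^+ 2) -> prim F f.
Proof.
move=> bf FC; split=> // s t s0 st tT.
pose G t := F t - \I_(0, t) f.
have GG r q : 0 <= r -> r <= q -> q <= T -> G q - G r = F q - F r - \I_(r, q) f.
  by move=> r0 rq qT; rewrite /G (int_chasles _ 0 r q)//; ring.
have := GG s t s0 st tT.
rewrite (@quadratic_increment_constant G C _ s t)// => [|r q r0 rq qT].
  by rewrite subrr => /esym/subr0_eq.
by rewrite GG// FC.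
Qed.

(** * Sums, products and exponentials of primitives *)

Lemma primD F G f g : prim F f -> prim G g ->
  prim (fun t => F t + G t) (fun t => f t + g t).
Proof.
move=> [bf Ff] [bg Gg]; split=> [|s t s0 st tT]; first exact: bmfD.
by rewrite intD// -Ff// -Gg//; ring.
Qed.

Lemma primM F G f g : prim F f -> prim G g ->
  prim (fun t => F t * G t) (fun t => f t * G t + F t * g t).
Proof.
move=> pF pG; have bF := prim_bmf _ _ pF; have bG := prim_bmf _ _ pG.
have [bf Ff] := pF; have [bg Gg] := pG.
have [L L0 FL] := prim_lipschitz _ _ pF; have [K K0 GK] := prim_lipschitz _ _ pG.
have [_ [M fM]] := bf; have [_ [N gN]] := bg.
apply: (prim_of_quadratic _ _ (`|M| * K + L * `|N|)).
  by apply: bmfD; apply: bmfM.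
move=> s t s0 st tT.
have inT x : s <= x <= t -> 0 <= x <= T.
  by move=> /andP[sx xt]; rewrite (le_trans s0) ?(le_trans xt).
(* This identity is exact: [G] is frozen at [s] and [F] at [t]. Unfreezing them changes the
   integrand by a multiple of [t - s], hence the integral by a quadratic amount. *)
have -> : F t * G t - F s * G s = \I_(s, t) (fun x => f x * G s + F t * g x).
  rewrite intD//; try by apply: bmfM => //; exact: bmf_cst.
  rewrite (eq_int _ (fun x => G s * f x)); last by move=> x _; rewrite mulrC.
  by rewrite !intZ// -Ff// -Gg//; ring.
rewrite -intB//; [|by apply: bmfD; apply: bmfM => //; exact: bmf_cst
                  |by apply: bmfD; apply: bmfM].
rewrite expr2 mulrA; apply: int_norm_le => //.
  by apply: bmfB; apply: bmfD; apply: bmfM => //; exact: bmf_cst.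
move=> x xst; have [sx xt] := andP xst; have xT := inT x xst.
have sT : 0 <= s <= T by rewrite s0 (le_trans st).
have tT' : 0 <= t <= T by rewrite tT (le_trans s0).
have -> : f x * G s + F t * g x - (f x * G x + F x * g x) =
  f x * (G s - G x) + (F t - F x) * g x by ring.
rewrite (le_trans (ler_normD _ _))// [leRHS]mulrDl lerD// normrM.
  rewrite -mulrA ler_pM//; first by rewrite (le_trans (fM _ xT))// ler_norm.
  rewrite (le_trans (GK _ _ _ _))// ler_wpM2l// distrC ger0_norm ?subr_ge0//.
  by rewrite lerD2r.
rewrite mulrAC ler_pM//; last by rewrite (le_trans (gN _ xT))// ler_norm.
rewrite (le_trans (FL _ _ _ _))// ler_wpM2l// ger0_norm ?subr_ge0//.
by rewrite lerD2l lerN2.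
Qed.

Lemma primZ c F f : prim F f -> prim (fun t => c * F t) (fun t => c * f t).
Proof.
move=> pF; apply: prim_eq (primM _ _ _ _ (prim_cst c) pF) _ _ => // t _.
by rewrite mul0r add0r.
Qed.

Lemma primB F G f g : prim F f -> prim G g ->
  prim (fun t => F t - G t) (fun t => f t - g t).
Proof.
move=> pF /(primZ (-1)) pG; apply: prim_eq (primD _ _ _ _ pF pG) _ _ => t _;
by rewrite mulN1r.
Qed.

(** By convexity the tangent at the larger of the two points lies below the graph, and its slope is
    at most [expR M]. *)
Lemma expR_lipschitz (M x y : R) : x <= M -> y <= M ->
  `|expR x - expR y| <= expR M * `|x - y|.
Proof.
wlog yx : x y / y <= x.
  move=> H xM yM; have [/H->//|/ltW /H] := leP y x.
  by rewrite distrC [`|x - y|]distrC => ->.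
move=> xM yM; rewrite !ger0_norm ?subr_ge0// ?ler_expR//.
have := expR_ge1Dx (y - x); rewrite -(ler_pM2l (expR_gt0 x)) -expRD subrKC.
move=> H; have : expR x * (x - y) <= expR M * (x - y).
  by rewrite ler_wpM2r ?subr_ge0// ler_expR.
by apply: le_trans; lra.
Qed.

(** The tangent inequalities at [y] and at [x] place the remainder between 0 and
    [(expR x - expR y) * (x - y)]; the Lipschitz bound finishes. *)
Lemma expR_taylor1 (M x y : R) : x <= M -> y <= M ->
  `|expR x - expR y - expR y * (x - y)| <= expR M * (x - y) ^+ 2.
Proof.
move=> xM yM; have lin (a b : R) : expR a * (b - a) <= expR b - expR a.
  have := expR_ge1Dx (b - a).
  by rewrite -(ler_pM2l (expR_gt0 a)) -expRD subrKC; lra.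
rewrite ger0_norm ?subr_ge0//.
apply: (@le_trans _ _ ((expR x - expR y) * (x - y))).
  by have := lin x y; lra.
rewrite (le_trans (ler_norm _))// normrM expr2 -[(x - y) * _]ger0_norm -?expr2 ?sqr_ge0//.
by rewrite expr2 normrM mulrA ler_wpM2r// expR_lipschitz.
Qed.

Lemma prim_expR F f : prim F f ->
  prim (fun t => expR (F t)) (fun t => f t * expR (F t)).
Proof.
move=> pF; have bF := prim_bmf _ _ pF; have bE := bmf_expR _ bF.
have [bf Ff] := pF; have [L L0 FL] := prim_lipschitz _ _ pF.
have [_ [M fM]] := bf; have [_ [K FK]] := bF.
have bfE : bmf (fun t => f t * expR (F t)) by exact: bmfM.
apply: (prim_of_quadratic _ _ (expR K * L ^+ 2 + `|M| * (expR K * L))) => //.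
move=> s t s0 st tT.
have sT : 0 <= s <= T by rewrite s0 (le_trans st).
have tT' : 0 <= t <= T by rewrite tT (le_trans s0).
have FleK x : 0 <= x <= T -> F x <= K by move=> /FK/ler_normlP[].
(* The first summand is a Taylor remainder, quadratic in [F t - F s]; the second compares
   [expR (F x)] with its value at [s]. *)
have -> : expR (F t) - expR (F s) - \I_(s, t) (fun x => f x * expR (F x)) =
  (expR (F t) - expR (F s) - expR (F s) * (F t - F s)) +
  \I_(s, t) (fun x => expR (F s) * f x - f x * expR (F x)).
  rewrite intB//; last by apply: bmfM => //; exact: bmf_cst.
  by rewrite intZ// Ff//; ring.
rewrite (le_trans (ler_normD _ _))// [leRHS]mulrDl lerD//.
  rewrite (le_trans (expR_taylor1 K _ _ _ _)) ?FleK//.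
  rewrite -mulrA ler_wpM2l ?expR_ge0// -exprMn -[leLHS]real_normK ?num_real//.
  by rewrite lerXn2r ?nnegrE ?mulr_ge0 ?subr_ge0// (le_trans (FL _ _ _ _))// ger0_norm ?subr_ge0.
rewrite expr2 mulrA; apply: int_norm_le => //.
  by apply: bmfB => //; apply: bmfM => //; exact: bmf_cst.
move=> x /andP[sx xt]; have xT : 0 <= x <= T by rewrite (le_trans s0) ?(le_trans xt).
rewrite [_ * f x]mulrC -mulrBr normrM -mulrA ler_pM//.
  by rewrite (le_trans (fM _ xT))// ler_norm.
rewrite (le_trans (expR_lipschitz K _ _ _ _)) ?FleK// -mulrA ler_wpM2l ?expR_ge0//.
rewrite (le_trans (FL _ _ _ _))// ler_wpM2l// distrC ger0_norm ?subr_ge0//.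
by rewrite lerD2r.
Qed.
End Primitives.

Ltac bmf_tac := repeat first
  [assumption | apply: bmf_cst | apply: bmfN | apply: bmfD | apply: bmfM | apply: bmf_expR].

(** * States, adjoints and the first-order condition *)

Section Control.
Context {R : realType} (T alpha beta c u1 R0 : R).
Hypothesis T0 : 0 < T.
Local Notation mu := (@lebesgue_measure R).
Local Notation bmf := (bmf T).
Local Notation prim := (prim T).
Implicit Types (u v w x y p : R -> R) (s t : R).

Definition control u := bmf u /\ forall t, 0 <= t <= T -> 0 <= u t <= u1.

Definition trajectory u x := x 0 = R0 /\ prim x (fun t => c - u t * x t).

Definition adjoint u p := p T = 0 /\ prim p (fun t => u t * p t - alpha).

Definition total_cost u x := \I_(0, T) (fun t => alpha * x t + beta * u t).

Lemma int_point f t : \I_(t, t) f = 0.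
Proof. by rewrite set_itv1 Rintegral_set1. Qed.

(** Variation of constants: with [U] the integral of [u], the solution is [exp(-U) * (R0 + c * J)],
    where [J' = exp(U)]. *)
Lemma trajectory_exists u : bmf u -> exists x, trajectory u x.
Proof.
move=> bu; pose U t := \I_(0, t) u; have pU : prim U u by exact: prim_int.
pose J t := \I_(0, t) (fun s => expR (U s)).
have pJ : prim J (fun t => expR (U t)).
  by apply: prim_int; exact: prim_bmf (prim_expR _ _ _ pU).
exists (fun t => expR (-1 * U t) * (R0 + c * J t)); split.
  by rewrite /U /J !int_point !mulr0 expR0 addr0 mul1r.
apply: prim_eq (primM _ _ _ _ _ (prim_expR _ _ _ (primZ _ (-1) _ _ pU))
  (primD _ _ _ _ _ (prim_cst _ R0) (primZ _ c _ _ pJ))) _ _ => // t _.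
by rewrite mulN1r expRN add0r; field; rewrite gt_eqF ?expR_gt0.
Qed.

(** Variation of constants backwards from [T]: [J T - J t] is the integral of [exp(-U)] over
    [[t, T]], so the terminal condition is built in. *)
Lemma adjoint_exists u : bmf u -> exists p, adjoint u p.
Proof.
move=> bu; pose U t := \I_(0, t) u; have pU : prim U u by exact: prim_int.
pose J t := \I_(0, t) (fun s => expR (-1 * U s)).
have pJ : prim J (fun t => expR (-1 * U t)).
  by apply: prim_int; exact: prim_bmf (prim_expR _ _ _ (primZ _ _ _ _ pU)).
exists (fun t => expR (U t) * (alpha * (J T - J t))); split.
  by rewrite subrr !mulr0.
apply: prim_eq (primM _ _ _ _ _ (prim_expR _ _ _ pU)
  (primZ _ alpha _ _ (primB _ _ _ _ _ (prim_cst _ (J T)) pJ))) _ _ => // t _.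
by rewrite mulN1r expRN sub0r; field; rewrite gt_eqF ?expR_gt0.
Qed.

(* Multiplying by exp (int v) turns the equation into D' = g exp (int v). *)
Lemma linear_ode_bound v g D (K : R) : control v -> bmf g ->
  (forall t, 0 <= t <= T -> `|g t| <= K) ->
  prim D (fun t => g t - v t * D t) ->
  forall t, 0 <= t <= T -> `|D t| <= `|D 0| + K * (expR (u1 * T) * T).
Proof.
move=> [bv vu1] bg gK pD t tT; have [t0 tleT] := andP tT.
have K0 : 0 <= K by rewrite (le_trans (normr_ge0 (g 0)))// gK// lexx ltW.
pose V t := \I_(0, t) v; have pV : prim V v by exact: prim_int.
have pE := prim_expR _ _ _ pV; have bE := prim_bmf _ _ _ pE.
have VT s : 0 <= s <= T -> 0 <= V s <= u1 * T.
  move=> /andP[s0 sT].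
  have vs r : 0 <= r <= s -> 0 <= v r <= u1.
    by move=> /andP[r0 rs]; apply: vu1; rewrite r0 (le_trans rs).
  apply/andP; split.
    rewrite -[leLHS](mul0r (s - 0)) -int_cst//; apply: (le_int T) => //; bmf_tac.
    by move=> r /vs/andP[].
  apply: (@le_trans _ _ (u1 * (s - 0))).
    by apply: (int_le T) => // r /vs/andP[].
  have /andP[h1 h2] : 0 <= v s <= u1 by apply: vs; rewrite s0 lexx.
  by rewrite subr0 ler_wpM2l//; exact: le_trans h2.
have [_ /(_ 0 t (lexx 0) t0 tleT) H] := primM _ _ _ _ _ pE pD.
have {}H : expR (V t) * D t = D 0 + \I_(0, t) (fun s => expR (V s) * g s).
  have V0 : V 0 = 0 by rewrite /V int_point.
  move/eqP: H; rewrite subr_eq V0 expR0 mul1r addrC => /eqP ->.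
  by congr (_ + _); apply: eq_int => s _; ring.
have [V0 _] := andP (VT t tT).
have : `|expR (V t) * D t| <= `|D 0| + K * (expR (u1 * T) * T).
  rewrite H (le_trans (ler_normD _ _))// lerD2l.
  apply: (@le_trans _ _ (expR (u1 * T) * K * (t - 0))).
    apply: (int_norm_le T) => //; first by bmf_tac.
    move=> s /andP[s0 st]; have sT : 0 <= s <= T by rewrite s0 (le_trans st).
    rewrite normrM ler_pM ?gK// gtr0_norm ?expR_gt0// ler_expR.
    by case/andP: (VT s sT).
  by rewrite subr0 mulrA [expR _ * K]mulrC ler_wpM2l// mulr_ge0 ?expR_ge0.
apply: le_trans; rewrite normrM ler_peMl// gtr0_norm ?expR_gt0//.
by rewrite -expR0 ler_expR.
Qed.

(* The adjoint of one control is paired with the trajectory of the other, so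
   that no remainder term appears. *)
Lemma cost_difference u v x y p : bmf u -> bmf v ->
  trajectory u x -> trajectory v y -> adjoint u p ->
  total_cost v y - total_cost u x =
  \I_(0, T) (fun t => (beta - p t * y t) * (v t - u t)).
Proof.
move=> bu bv [x0 px] [y0 py] [pT pp].
have bx := prim_bmf _ _ _ px; have by' := prim_bmf _ _ _ py.
have bp := prim_bmf _ _ _ pp.
(* The product [p * (y - x)] vanishes at [T] because [p T = 0] and at 0 because the initial values
   agree. The integral of its derivative is therefore 0, and adding it to the cost difference gives
   the formula. *)
have [_] := primM _ _ _ _ _ pp (primB _ _ _ _ _ py px).
move=> /(_ 0 T (lexx 0) (ltW T0) (lexx T)).
rewrite pT mul0r y0 x0 subrr mulr0 subrr => H.
rewrite /total_cost -(intB T)//; [|bmf_tac..].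
set D := Rintegral _ _ _; set I := Rintegral _ _ _ in H.
transitivity (D + I); first by rewrite -H addr0.
rewrite /D /I -(intD T)//; [|bmf_tac..].
by apply: eq_int => t _; ring.
Qed.

(** Let [A] be the integral in the conclusion. For [v = u + e * (w - u)] the cost changes by [e]
    times [A] minus an integral containing [y - x], which is at most [e * C]. Optimality gives
    [A + e * C >= 0] for all [e] in (0, 1]. *)
Lemma first_order_condition u x p : control u -> trajectory u x -> adjoint u p ->
  (forall v y, control v -> trajectory v y -> total_cost u x <= total_cost v y) ->
  forall w, control w -> 0 <= \I_(0, T) (fun t => (beta - p t * x t) * (w t - u t)).
Proof.
move=> [bu uu1] xu pu opt w [bw wu1].
have bx := prim_bmf _ _ _ xu.2; have bp := prim_bmf _ _ _ pu.2.
have [_ [P pP]] := bp.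
have T00 : 0 <= (0 : R) <= T by rewrite lexx ltW.
have u10 : 0 <= u1 by case/andP: (uu1 0 T00); exact: le_trans.
have P0 : 0 <= P by rewrite (le_trans (normr_ge0 (p 0)))// pP.
(* [B] bounds all perturbed states, [u1 * B * E] bounds [|y - x| / e], and [C] below bounds the
   remainder divided by [e]. *)
pose E := expR (u1 * T) * T; pose B := `|R0| + `|c| * E.
have E0 : 0 <= E by rewrite mulr_ge0 ?expR_ge0 ?ltW.
have B0 : 0 <= B by apply: addr_ge0 (normr_ge0 _) (mulr_ge0 (normr_ge0 _) E0).
pose C := P * (u1 * B * E) * u1 * T.
have C0 : 0 <= C.
  exact: mulr_ge0 (mulr_ge0 (mulr_ge0 P0 (mulr_ge0 (mulr_ge0 u10 B0) E0)) u10) (ltW T0).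
set A := Rintegral _ _ _; rewrite leNgt; apply/negP => A0.
have main e : 0 < e <= 1 -> 0 <= A + e * C.
  move=> /andP[e0 e1].
  pose v t := u t + e * (w t - u t).
  have bv : bmf v by rewrite /v; bmf_tac.
  have cv : control v.
    split=> // t tT; have := uu1 t tT; have := wu1 t tT; rewrite /v; nra.
  have [y yv] := trajectory_exists v bv.
  have by' := prim_bmf _ _ _ yv.2.
  have wuK t : 0 <= t <= T -> `|w t - u t| <= u1.
    by move=> tT; have := uu1 t tT; have := wu1 t tT; rewrite ler_norml; lra.
  have yB t : 0 <= t <= T -> `|y t| <= B.
    move=> tT; rewrite /B -yv.1; apply: (linear_ode_bound v (fun=> c)) => //.
      exact: bmf_cst.
    exact: yv.2.
  have yxE t : 0 <= t <= T -> `|y t - x t| <= e * (u1 * B * E).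
    move=> tT.
    (* The difference [D = y - x] starts at 0 and solves [D' = g - u * D] with
       [g = - e * (w - u) * y]. *)
    have := @linear_ode_bound u (fun t => - (e * (w t - u t) * y t))
      (fun t => y t - x t) (e * (u1 * B)) (conj bu uu1).
    rewrite yv.1 xu.1 subrr normr0 add0r -!mulrA; apply => //; first by bmf_tac.
      move=> s sT; rewrite normrN -mulrA normrM gtr0_norm// ler_pM2l//.
      by rewrite normrM ler_pM ?wuK ?yB.
    apply: prim_eq (primB _ _ _ _ _ yv.2 xu.2) _ _ => // s _.
    by rewrite /v; ring.
  have := opt v y cv yv; rewrite -subr_ge0 (cost_difference u v x y p)//.
  have -> : \I_(0, T) (fun t => (beta - p t * y t) * (v t - u t)) =
    e * (A - \I_(0, T) (fun t => p t * (y t - x t) * (w t - u t))).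
    rewrite -(intB T)//; [|bmf_tac..]; rewrite -(intZ T)//; [|bmf_tac].
    by apply: eq_int => t _; rewrite /v; ring.
  rewrite pmulr_rge0// subr_ge0 => IA.
  have : `|\I_(0, T) (fun t => p t * (y t - x t) * (w t - u t))|
      <= P * (e * (u1 * B * E)) * u1 * (T - 0).
    apply: (int_norm_le T) => //; [by bmf_tac|exact: ltW|move=> t tT].
    by rewrite 2!normrM ler_pM ?wuK// ?mulr_ge0// ler_pM ?pP ?yxE.
  move=> /ler_normlP[H _]; rewrite /C; lra.
have D0 : 0 < C *+ 2 - A by lra.
(* For this [e], [A + e * C = A * (C - A) / (2 * C - A)], which is negative when [A < 0 <= C]. *)
have /main : 0 < - A / (C *+ 2 - A) <= 1.
  by rewrite divr_gt0 ?oppr_gt0// ler_pdivrMr// mul1r; lra.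
rewrite leNgt => /negP; apply.
rewrite -(pmulr_llt0 _ D0) mulrDl mulrAC divfK ?gt_eqF//; nra.
Qed.

Lemma ae_eq0_of_int_le0 f : bmf f -> (forall t, 0 <= t <= T -> 0 <= f t) ->
  \I_(0, T) f <= 0 -> {ae mu, forall t, `[0, T]%classic t -> f t = 0}.
Proof.
move=> bf f0 If.
have intf := bmf_integrable T f 0 T bf (lexx 0) (lexx T).
have If0 : \I_(0, T) f = 0.
  apply/eqP; rewrite eq_le If; apply: Rintegral_ge0 => t /=.
  by rewrite in_itv/=; exact: f0.
have mT : measurable (`[0, T]%classic : set R) by exact: measurable_itv.
have intf0 : (\int[mu]_(t in `[0%R, T]) `|(EFin \o f) t| = 0)%E.
  transitivity (\int[mu]_(t in `[0%R, T]) (EFin \o f) t)%E.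
    by apply: eq_integral => t; rewrite inE/= in_itv/= => /f0 ft; rewrite ger0_norm.
  rewrite -[LHS]fineK; first by congr EFin.
  exact: integrable_fin_num.
have mf : measurable_fun `[0, T] (EFin \o f).
  by case: bf => mf _; apply/measurable_EFinP.
have [+ _] := ae_eq_integral_abs mu mT mf.
by move=> /(_ intf0); apply: filterS => t H /H [].
Qed.
End Control.

(** * Changes on null sets *)

Section AlmostEverywhere.
Context {R : realType} (T : R).
Local Notation mu := (@lebesgue_measure R).
Implicit Types (f g F : R -> R) (s t : R).

Lemma lebesgue_aeS (P Q : R -> Prop) : (forall x, P x -> Q x) ->
  {ae mu, forall x, P x} -> {ae mu, forall x, Q x}.
Proof. by move=> PQ; apply: filterS PQ; exact: (ae_filter_ringOfSetsType mu). Qed.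

Lemma lebesgue_aeS2 (P Q S : R -> Prop) : (forall x, P x -> Q x -> S x) ->
  {ae mu, forall x, P x} -> {ae mu, forall x, Q x} -> {ae mu, forall x, S x}.
Proof. by move=> PQS; apply: filterS2 PQS; exact: (ae_filter_ringOfSetsType mu). Qed.

Lemma eq_int_ae f g s t : measurable_fun `[0, T] f -> measurable_fun `[0, T] g ->
  {ae mu, forall x, `[0, T]%classic x -> f x = g x} -> 0 <= s -> t <= T ->
  \I_(s, t) f = \I_(s, t) g.
Proof.
move=> mf mg fg s0 tT.
have sub : `[s, t] `<=` `[0, T] by apply: subset_itv; rewrite bnd_simp.
congr fine; apply: ae_eq_integral.
- exact: measurable_itv.
- by apply/measurable_EFinP; apply: measurable_funS mf.
- by apply/measurable_EFinP; apply: measurable_funS mg.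
- by apply: lebesgue_aeS fg => x /= fgx /sub xT; rewrite fgx.
Qed.

(** This allows the control in the state and adjoint equations to be changed on a null set while [x]
    and [p] stay the same. *)
Lemma prim_ae F f g : prim T F f -> bmf T g ->
  {ae mu, forall x, `[0, T]%classic x -> f x = g x} -> prim T F g.
Proof.
move=> [bf Ff] bg fg; split=> // s t s0 st tT.
by rewrite Ff//; apply: eq_int_ae => //; [case: bf|case: bg].
Qed.

Lemma bmf_if f g h : bmf T f -> bmf T g -> bmf T h ->
  bmf T (fun t => if 0 < h t then f t else g t).
Proof.
move=> [mf [M fM]] [mg [K gK]] [mh _]; split.
  have mT : measurable (`[0, T]%classic : set R) by exact: measurable_itv.
  apply: measurable_fun_if => //.
  - exact: measurable_fun_ltr.
  - by apply: measurable_funS mf => // x [].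
  - by apply: measurable_funS mg => // x [].
exists (Num.max M K) => t tT; rewrite le_max.
by case: ifP => _; rewrite ?fM ?gK ?orbT.
Qed.
End AlmostEverywhere.

(** * The bang-bang principle *)

Section BangBang.
Context {R : realType} (T alpha beta c u1 R0 : R).
Hypothesis T0 : 0 < T.
Local Notation mu := (@lebesgue_measure R).
Local Notation bmf := (bmf T).
Local Notation prim := (prim T).
Implicit Types (u v w x y p : R -> R) (s t : R).

(** Test the first-order condition with [w] equal to [u1] where [p * x > beta] and to 0 elsewhere.
    The integrand [(beta - p * x) * (w - u)] is nowhere positive while its integral is nonnegative,
    so it vanishes almost everywhere. *)
Lemma bang_bang_ae u x p : control T u1 u -> trajectory T c R0 u x ->
  adjoint T alpha u p ->
  (forall v y, control T u1 v -> trajectory T c R0 v y ->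
     total_cost T alpha beta u x <= total_cost T alpha beta v y) ->
  {ae mu, forall t, `[0, T]%classic t ->
    (beta < p t * x t -> u t = u1) /\ (p t * x t < beta -> u t = 0)}.
Proof.
move=> cu xu pu opt; have [bu uu1] := cu.
have bx := prim_bmf _ _ _ xu.2; have bp := prim_bmf _ _ _ pu.2.
have bs : bmf (fun t => p t * x t - beta) by bmf_tac.
pose w t := if 0 < p t * x t - beta then u1 else 0.
have bw : bmf w by apply: bmf_if => //; exact: bmf_cst.
have cw : control T u1 w.
  split=> // t tT; have := uu1 t tT; rewrite /w; case: ifP => _; lra.
have := first_order_condition T alpha beta c u1 R0 T0 u x p cu xu pu opt w cw.
rewrite -oppr_le0 -mulN1r -(intZ T)//; [|by bmf_tac] => I0.
have b1 : bmf (fun t => -1 * ((beta - p t * x t) * (w t - u t))) by bmf_tac.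
have := ae_eq0_of_int_le0 T _ b1 _ I0.
have H : forall t, 0 <= t <= T -> 0 <= -1 * ((beta - p t * x t) * (w t - u t)).
  move=> t tT; have := uu1 t tT; rewrite /w; case: ltrP => h; nra.
move=> /(_ H); apply: lebesgue_aeS => t + tT => /(_ tT).
rewrite /w; case: ltrP => h /eqP;
  rewrite mulN1r oppr_eq0 mulf_eq0 !subr_eq0 => /orP[/eqP h1|/eqP h1]; split; lra.
Qed.

End BangBang.

Lemma small_pos {R : realType} (a b d : R) : 0 < a -> 0 < b -> 0 < d ->
  exists2 h, 0 < h & [/\ h < a, h < b & h < d].
Proof.
move=> a0 b0 d0; pose m := Num.min a (Num.min b d).
have m0 : 0 < m by rewrite !lt_min a0 b0.
have mh : m / 2 < m by lra.
exists (m / 2); first by rewrite divr_gt0.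
have : m / 2 < Num.min a (Num.min b d) by exact: mh.
by rewrite !lt_min => /and3P[].
Qed.

(** * Local minima and the superlevel set of a function with Lipschitz derivative *)

Section Superlevel.
Context {R : realType} (T beta : R) (phi psi chi : R -> R).
Hypotheses (T0 : 0 < T) (beta0 : 0 < beta).
Hypotheses (pphi : prim T phi psi) (ppsi : prim T psi chi).

(** Since [psi] is Lipschitz, a nonzero value at [m] keeps its sign nearby, and [phi] then drops
    strictly below [phi m] on one side. *)
Lemma derivative_eq0_at_minimum m r : 0 < m < T -> 0 < r ->
  (forall t, 0 <= t <= T -> `|t - m| < r -> phi m <= phi t) -> psi m = 0.
Proof.
move=> /andP[m0 mT] r0 mmin.
have mT' : 0 <= m <= T by rewrite !ltW.
have [L L0 psiL] := prim_lipschitz _ _ _ ppsi.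
have [bpsi phiE] := pphi.
apply/eqP/negPn/negP => psi0.
(* A step [h] below this bound satisfies [L * h < |psi m|]; the [+ 1] covers [L = 0]. *)
have a0 : 0 < `|psi m| / (L + 1) by rewrite divr_gt0 ?normr_gt0// ltr_wpDl.
have Tm : 0 < T - m by rewrite subr_gt0.
have mr : 0 < Num.min m r by rewrite lt_min m0.
have [h h0 [ha hT]] := small_pos _ _ _ a0 Tm mr; rewrite lt_min => /andP[hm hr].
have {}ha : L * h < `|psi m|.
  by move: ha; rewrite ltr_pdivlMr ?ltr_wpDl//; nra.
have near t : 0 <= t <= T -> m - h <= t <= m + h -> psi m - L * h <= psi t <= psi m + L * h.
  move=> tT th; have : L * `|t - m| <= L * h by rewrite ler_wpM2l// ler_norml; lra.
  by have := psiL m t mT' tT; rewrite ler_norml => /andP[]; lra.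
case: (ltrgt0P (psi m)) psi0 ha => // psi0 _ ha.
- have hmT : 0 <= m - h <= T by lra.
  have := mmin (m - h) hmT; rewrite (_ : m - h - m = - h) ?normrN ?gtr0_norm//; last by ring.
  move=> /(_ hr); rewrite leNgt => /negP; apply.
  rewrite -subr_gt0 phiE; try lra.
  have : (psi m - L * h) * (m - (m - h)) <= \I_((m - h), m) psi.
    rewrite -int_cst; last lra.
    apply: (le_int T) => //; [exact: bmf_cst|lra|lra|move=> t tm].
    by have /andP[] : psi m - L * h <= psi t <= psi m + L * h by apply: near; lra.
  by apply: lt_le_trans; rewrite mulr_gt0; lra.
- have hmT : 0 <= m + h <= T by lra.
  have := mmin (m + h) hmT; rewrite (_ : m + h - m = h) ?gtr0_norm//; last by ring.
  move=> /(_ hr); rewrite leNgt => /negP; apply.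
  rewrite -subr_lt0 phiE; try lra.
  have : \I_(m, (m + h)) psi <= (psi m + L * h) * (m + h - m).
    apply: (int_le T) => //; [lra|lra|lra|move=> t tm].
    by have /andP[] : psi m - L * h <= psi t <= psi m + L * h by apply: near; lra.
  by move=> /le_lt_trans; apply; rewrite nmulr_rlt0; lra.
Qed.

Lemma concave_not_minimum m r d q : 0 < m < T -> 0 < r -> 0 < d -> 0 < q ->
  (forall t, 0 <= t <= T -> `|t - m| < q -> chi t <= - d) ->
  ~ (forall t, 0 <= t <= T -> `|t - m| < r -> phi m <= phi t).
Proof.
move=> mT r0 d0 q0 chid mmin; have psi0 := derivative_eq0_at_minimum m r mT r0 mmin.
have [m0 mT'] := andP mT.
have Tm : 0 < T - m by rewrite subr_gt0.
have [h h0 [hr hq hT]] := small_pos _ _ _ r0 q0 Tm.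
have [bchi psiE] := ppsi; have [bpsi phiE] := pphi.
have m1 : 0 <= m by rewrite ltW.
have psi_le t : m <= t <= m + h -> psi t <= - d * (t - m).
  move=> /andP[mt tm]; have tT : t <= T by lra.
  rewrite -[psi t]subr0 -psi0 psiE//.
  apply: (int_le T) => //.
  by move=> s sm; apply: chid; [lra|rewrite ger0_norm; lra].
have hm : m + h - m = h by ring.
have := mmin (m + h); rewrite hm gtr0_norm// => /(_ _ hr) H.
have {H} : phi m <= phi (m + h) by apply: H; lra.
rewrite leNgt => /negP; apply.
have m2 : m <= m + h / 2 by lra.
have m3 : m + h / 2 <= m + h by lra.
have m4 : m + h <= T by lra.
(* On the first half of [[m, m + h]] one only uses [psi <= 0]; on the second half
   [psi <= - d * h / 2], which makes the decrease of [phi] strict. *)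
rewrite -subr_lt0 phiE ?(le_trans m2)// (int_chasles T psi m (m + h / 2))//.
have i1 : \I_(m, (m + h / 2)) psi <= 0 * (m + h / 2 - m).
  apply: (int_le T) => //; first exact: le_trans m4.
  move=> t tm; apply: le_trans (psi_le t _) _; first by lra.
  by rewrite mulNr oppr_le0 mulr_ge0; lra.
have i2 : \I_((m + h / 2), (m + h)) psi <= (- d * (h / 2)) * (m + h - (m + h / 2)).
  apply: (int_le T) => //; first by lra.
  move=> t tm; apply: le_trans (psi_le t _) _; first by lra.
  by rewrite !mulNr lerN2 ler_pM2l//; lra.
have : 0 < d * (h / 2) * (h / 2) by rewrite !mulr_gt0// divr_gt0.
by lra.
Qed.

Hypothesis no_low_minimum : forall m r, 0 < m < T -> 0 < r -> phi m <= beta ->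
  ~ (forall t, 0 <= t <= T -> `|t - m| < r -> phi m <= phi t).

Lemma superlevel_convex a b t : 0 <= a -> b <= T -> a < t < b ->
  beta <= phi a -> beta <= phi b -> beta < phi t.
Proof.
move=> a0 bT /andP[at_ tb] phia phib; rewrite ltNge; apply/negP => phit.
have ab := lt_trans at_ tb.
have cphi : {within `[a, b], continuous phi}.
  apply: continuous_subspaceW (prim_continuous _ _ _ pphi).
  by apply: subset_itv; rewrite bnd_simp.
have [m mab mmin] := EVT_min (ltW ab) cphi.
(* The minimum over [[a, b]] is at most [phi t <= beta]. If it sits at an endpoint, where
   [phi >= beta], then [t] itself is an interior minimizer. *)
have [m' [m'ab m't m'min]] : exists m', [/\ a < m' < b, phi m' <= beta &
    forall s, a <= s <= b -> phi m' <= phi s].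
  have {}mmin s : a <= s <= b -> phi m <= phi s.
    by move=> sab; apply: mmin; rewrite in_itv.
  have mle : phi m <= phi t by apply: mmin; rewrite (ltW at_) (ltW tb).
  move: mab; rewrite in_itv/= => /andP[am mb].
  have [ma|ma] := eqVneq m a.
    exists t; split => //; first by rewrite at_ tb.
    by move=> s /mmin; apply: le_trans; rewrite ma (le_trans phit).
  have [mb'|mb'] := eqVneq m b.
    exists t; split => //; first by rewrite at_ tb.
    by move=> s /mmin; apply: le_trans; rewrite mb' (le_trans phit).
  exists m; split => //; last exact: le_trans phit.
  by rewrite !lt_neqAle am mb eq_sym ma mb'.
have [am bm] := andP m'ab.
(* Points within this radius of [m'] stay in [[a, b]], so the minimum is a local one. *)
apply: (no_low_minimum m' (Num.min (m' - a) (b - m'))) => //.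
- lra.
- by rewrite lt_min; apply/andP; lra.
- move=> s sT; rewrite lt_min !ltr_norml => /andP[h1 h2].
  by apply: m'min; lra.
Qed.

Hypothesis phiT : phi T = 0.

(** When the set [phi >= beta] is nonempty, [t1] and [t2] are its infimum and supremum; they may
    coincide. *)
Lemma superlevel_shape :
  (forall t, 0 <= t <= T -> phi t < beta) \/
  exists t1 t2, [/\ 0 <= t1 <= t2, t2 < T, forall t, t1 < t < t2 -> beta < phi t &
    forall t, 0 <= t <= T -> t < t1 \/ t2 < t -> phi t < beta].
Proof.
pose K := [set t | 0 <= t <= T /\ beta <= phi t].
have [K0|/set0P K0] := eqVneq K set0; [left|right].
  move=> t tT; rewrite ltNge; apply/negP => h.
  by have : K t by []; rewrite K0.
have [L L0 phiL] := prim_lipschitz _ _ _ pphi.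
have L1 : 0 < L + 1 by rewrite ltr_wpDl.
(* From [phi T = 0], a point with [phi t >= beta] has [beta <= L * (T - t)], which keeps the whole
   set, and so its supremum, away from [T]. *)
pose T' := T - beta / (L + 1).
have T'T : T' < T by rewrite /T' ltrBlDr ltrDl divr_gt0.
have KT' t : K t -> t <= T'.
  move=> [tT phit]; rewrite /T' lerBrDr -lerBrDl ler_pdivrMr//.
  have := phiL t T tT; rewrite phiT lexx ltW// => /(_ isT).
  by rewrite ler_norml (ger0_norm (x := T - t)); [|lra] => /andP[]; nra.
have Kub : has_ubound K by exists T' => t /KT'.
have Klb : has_lbound K by exists 0 => t [/andP[]].
exists (inf K), (sup K); have [k Kk] := K0; split.
- rewrite lb_le_inf//=; first by rewrite (le_trans (ge_inf Klb Kk))// ub_le_sup.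
  by move=> t [/andP[]].
- by apply: le_lt_trans T'T; apply: ge_sup => // t /KT'.
- move=> t /andP[/(inf_lt (ex_intro _ k Kk))[a [aT pa] at_]].
  move=> /(sup_gt (ex_intro _ k Kk))[b [bT pb] tb].
  apply: (superlevel_convex a b) => //; [by case/andP: aT|by case/andP: bT|].
  by rewrite at_ tb.
- move=> t tT h; rewrite ltNge; apply/negP => pt.
  have Kt : K t by [].
  case: h; rewrite ltNge => /negP; apply; [exact: ge_inf|exact: ub_le_sup].
Qed.

End Superlevel.

(** * Concavity of the switching function at low critical points *)

Section Switching.
Context {R : realType} (T alpha beta c u1 : R) (u x p : R -> R).
Hypotheses (T0 : 0 < T) (alpha0 : 0 < alpha) (beta0 : 0 < beta) (c0 : 0 < c).
Hypothesis u1_small : beta * u1 ^+ 2 < alpha * c.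
Hypothesis cu : control T u1 u.
Hypothesis px : prim T x (fun t => c - u t * x t).
Hypothesis pu : adjoint T alpha u p.
Hypothesis u_off : forall t, 0 <= t <= T -> p t * x t < beta -> u t = 0.

Let phi t := p t * x t.
Let psi t := c * p t - alpha * x t.
Let X t := alpha * x t + c * p t.
Let chi t := u t * X t - 2 * alpha * c.

Lemma prim_phi : prim T phi psi.
Proof.
by apply: prim_eq (primM _ _ _ _ _ pu.2 px) _ _ => // t _; rewrite /psi; ring.
Qed.

Lemma prim_psi : prim T psi chi.
Proof.
apply: prim_eq (primB _ _ _ _ _ (primZ _ c _ _ pu.2) (primZ _ alpha _ _ px)) _ _ => // t _.
by rewrite /chi /X; ring.
Qed.

(* At a zero of psi on the level phi = beta, X^2 = 4 alpha beta c, so the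
   hypothesis on u1 keeps u1 X below 2 alpha c. *)
Lemma chi_negative_near m : 0 <= m <= T -> phi m <= beta -> psi m = 0 ->
  exists d r, [/\ 0 < d, 0 < r &
    forall t, 0 <= t <= T -> `|t - m| < r -> chi t <= - d].
Proof.
move=> mT phim psim; have ac0 : 0 < alpha * c by rewrite mulr_gt0.
have [phimlt|phimeq] : phi m < beta \/ phi m = beta.
  by move: phim; rewrite le_eqVlt => /predU1P[]; [right|left].
  have [L L0 phiL] := prim_lipschitz _ _ _ prim_phi.
  have L1 : 0 < L + 1 by rewrite ltr_wpDl.
  (* Within this radius [phi] stays below [beta], so [u = 0] and [chi] equals [- 2 * alpha * c]. *)
  exists (2 * alpha * c), ((beta - phi m) / (L + 1)); split.
  - by rewrite -mulrA mulr_gt0.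
  - by rewrite divr_gt0// subr_gt0.
  - move=> t tT; rewrite ltr_pdivlMr// => th.
    have := phiL m t mT tT; rewrite ler_norml => /andP[_ h].
    rewrite /chi u_off//; first by rewrite mul0r sub0r.
    rewrite -/(phi t); have := normr_ge0 (t - m); nra.
have pX : prim T X (fun t => alpha * (c - u t * x t) + c * (u t * p t - alpha)).
  exact: primD (primZ _ _ _ _ px) (primZ _ _ _ _ pu.2).
have [L L0 XL] := prim_lipschitz _ _ _ pX.
have [u00 u10] := andP (cu.2 m mT).
have u1X : u1 * X m < 2 * alpha * c.
  have XE : X m ^+ 2 = 4 * (alpha * c) * beta.
    have -> : X m ^+ 2 = psi m ^+ 2 + 4 * (alpha * c) * phi m.
      by rewrite /X /psi /phi; ring.
    by rewrite psim phimeq expr0n add0r.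
  (* The negation makes both sides nonnegative, so they can be squared: [4 * (alpha * c)^2 <= 4 *
     alpha * c * beta * u1^2], against [u1_small]. *)
  rewrite ltNge; apply/negP => H.
  have : (2 * alpha * c) ^+ 2 <= (u1 * X m) ^+ 2.
    by rewrite lerXn2r ?nnegrE//; lra.
  rewrite [in leRHS]exprMn XE.
  have : 4 * (alpha * c) * (beta * u1 ^+ 2) < 4 * (alpha * c) * (alpha * c).
    by rewrite ltr_pM2l// mulr_gt0.
  by lra.
(* Half of the gap at [m] is spent on the variation of [u1 * X] near [m]; the other half remains as
   the bound. *)
pose d := (2 * alpha * c - u1 * X m) / 2.
have d0 : 0 < d by rewrite divr_gt0// subr_gt0.
have K0 : 0 < u1 * L + 1 by rewrite ltr_wpDl// mulr_ge0//; lra.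
exists (Num.min d (2 * alpha * c)), (d / (u1 * L + 1)); split.
- by rewrite lt_min d0 -mulrA mulr_gt0.
- by rewrite divr_gt0.
- move=> t tT; rewrite ltr_pdivlMr// => th.
  have := XL m t mT tT; rewrite ler_norml => /andP[_ h].
  have [ut0 ut1] := andP (cu.2 t tT).
  have n0 := normr_ge0 (t - m).
  have u1h : u1 * (X t - X m) <= u1 * (L * `|t - m|) by rewrite ler_wpM2l//; lra.
  (* Nothing is known here about [u t] beyond its bounds: [u * X] is at most 0 if [X <= 0], and at
     most [u1 * X] otherwise. *)
  rewrite /chi; have [X0|X0] := leP (X t) 0.
    apply: (@le_trans _ _ (- (2 * alpha * c))); last by rewrite lerN2 ge_min lexx orbT.
    by rewrite -[leRHS]add0r lerD2r mulr_ge0_le0.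
  apply: (@le_trans _ _ (- d)); last by rewrite lerN2 ge_min lexx.
  have : u t * X t <= u1 * X t by rewrite ler_wpM2r// ltW.
  by rewrite /d in th *; lra.
Qed.

Lemma switching_shape :
  (forall t, 0 <= t <= T -> phi t < beta) \/
  exists t1 t2, [/\ 0 <= t1 <= t2, t2 < T, forall t, t1 < t < t2 -> beta < phi t &
    forall t, 0 <= t <= T -> t < t1 \/ t2 < t -> phi t < beta].
Proof.
apply: (superlevel_shape T beta phi psi) => //; first exact: prim_phi.
  move=> m r mT r0 phim mmin.
  have psim := derivative_eq0_at_minimum _ _ _ _ prim_phi prim_psi m r mT r0 mmin.
  have mT' : 0 <= m <= T by case/andP: mT => *; rewrite !ltW.
  have [d [q [d0 q0 chid]]] := chi_negative_near m mT' phim psim.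
  exact: concave_not_minimum prim_phi prim_psi m r d q mT r0 d0 q0 chid mmin.
by rewrite /phi pu.1 mul0r.
Qed.

End Switching.

(** * From essentially bounded controls to pointwise bounded ones *)

Section Reduction.
Context {R : realType} (T alpha beta sigma u1 R0 : R) (N : nat).
Hypotheses (T0 : 0 < T) (u1_gt0 : 0 < u1).
Local Notation mu := (@lebesgue_measure R).
Local Notation c := (N%:R * sigma ^+ 2).
Implicit Types (u v x y : R -> R) (s t : R).

Lemma continuous_bmf x : {within `[0, T]%classic, continuous x} -> bmf T x.
Proof.
move=> cx; split; first exact: subspace_continuous_measurable_fun.
have [M _ xM] := EVT_max (ltW T0) cx; have [m _ mx] := EVT_min (ltW T0) cx.
exists (Num.max (x M) (- x m)) => t tT.
have tI : t \in `[0, T] by rewrite in_itv.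
by rewrite ler_norml lerNl !le_max lerN2 xM ?mx ?orbT.
Qed.

(** The state equation is in integral form, so changing the control on a null set keeps the
    state. *)
Lemma is_state_trajectory u v x : bmf T v -> measurable_fun `[0, T] u ->
  {ae mu, forall t, `[0, T]%classic t -> u t = v t} ->
  is_state T R0 sigma N u x -> trajectory T c R0 v x.
Proof.
move=> bv mu_ uv [cx [_ xE]]; have bx := continuous_bmf x cx.
have bf : bmf T (fun t => c - v t * x t).
  by apply: bmfB; [exact: bmf_cst|exact: bmfM].
have {}xE t : 0 <= t <= T ->
    x t = R0 + Rintegral mu `[0, t] (fun s => c - v s * x s).
  move=> tT; rewrite xE//; congr (_ + _); have [t0 tleT] := andP tT.
  apply: (@eq_int_ae _ T) => //; [|by case: bf|].
    apply: measurable_funD; last exact: measurable_cst.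
    apply: measurable_funM; last by case: bx.
    exact: measurableT_comp.
  by apply: lebesgue_aeS uv => s us /us ->; ring.
split; first by rewrite xE ?int_point ?addr0// lexx ltW.
split=> // s t s0 st tT.
rewrite !xE ?(le_trans s0)// ?s0 ?(le_trans st)//.
by rewrite (int_chasles T _ 0 s t)//; ring.
Qed.

Lemma trajectory_is_state v y : trajectory T c R0 v y -> is_state T R0 sigma N v y.
Proof.
move=> [y0 py]; split; first exact: prim_continuous py.
have [bf yE] := py.
have bg : bmf T (fun s => - v s * y s + c) by apply: bmf_eq bf _ => t _; ring.
split=> [|t /andP[t0 tT]].
  exact: (bmf_integrable T (fun s => - v s * y s + c)).
rewrite -y0 -[LHS](subrKC (y 0)) yE//; congr (_ + _).
by apply: eq_int => s _; ring.
Qed.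

(** Clamping [uh] to [[0, u1]] changes it only on a null set, which preserves state and cost. Every
    pointwise bounded competitor is admissible, so optimality carries over. *)
Lemma optimal_bounded_representative uh : optimal T alpha beta sigma u1 R0 N uh ->
  exists u x, [/\ control T u1 u,
    {ae mu, forall t, `[0, T]%classic t -> uh t = u t},
    trajectory T c R0 u x &
    forall v y, control T u1 v -> trajectory T c R0 v y ->
      total_cost T alpha beta u x <= total_cost T alpha beta v y].
Proof.
move=> [[muh uhb] [x [xstate xopt]]].
pose u t := Num.min (Num.max (uh t) 0) u1.
have cu : control T u1 u.
  have ub t : 0 <= u t <= u1.
    by rewrite /u le_min le_max lexx orbT ltW//= ge_min lexx orbT.
  split=> [|t _]//; split.
    apply: measurable_minr; last exact: measurable_cst.
    by apply: measurable_maxr => //; exact: measurable_cst.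
  by exists u1 => t _; have /andP[u0 ule] := ub t; rewrite ger0_norm.
have uhu : {ae mu, forall t, `[0, T]%classic t -> uh t = u t}.
  apply: lebesgue_aeS uhb => t b /b /andP[u0 ule].
  by rewrite /u max_l// min_l.
exists u, x; split=> //.
  by apply: is_state_trajectory xstate => //; case: cu.
move=> v y cv yv.
have -> : total_cost T alpha beta u x = cost T alpha beta uh x.
  have [bx _] := continuous_bmf x xstate.1.
  apply: (@eq_int_ae _ T) => //.
  - apply: measurable_funD; apply: measurable_funM => //; try exact: measurable_cst.
    by case: cu => -[].
  - by apply: measurable_funD; apply: measurable_funM => //; exact: measurable_cst.
  - by apply: lebesgue_aeS uhu => t h /h ->.
apply: xopt; last exact: trajectory_is_state.
have [[mv _] vb] := cv; split=> //.
by apply: aeW => t /=; rewrite in_itv; exact: vb.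
Qed.
End Reduction.

(** * Reading off the three forms *)

Lemma lebesgue_ae_neq (R : realType) (a : R) :
  {ae @lebesgue_measure R, forall t, t <> a}.
Proof.
exists [set a]; split; [exact: measurable_set1|exact: lebesgue_measure_set1|].
by move=> t /= /contrapT.
Qed.

Theorem theorem1 (R : realType) (T alpha beta sigma u1 R0 : R) (N : nat)
  (hT : 0 < T) (halpha : 0 < alpha) (hbeta : 0 < beta) (hsigma : 0 < sigma)
  (hu1 : 0 < u1) (hN : (0 < N)%N) (hR0 : 0 <= R0)
  (hcond : u1 < Num.sqrt (alpha * N%:R * sigma ^+ 2 / beta))
  (uh : R -> R) (hopt : optimal T alpha beta sigma u1 R0 N uh) :
  {ae @lebesgue_measure R, forall t, `]0, T[%classic t -> uh t = 0}
  \/ (exists t1, 0 < t1 < T /\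
        {ae @lebesgue_measure R, forall t, `]0, t1[%classic t -> uh t = u1} /\
        {ae @lebesgue_measure R, forall t, `]t1, T[%classic t -> uh t = 0})
  \/ (exists t1 t2, 0 < t1 < t2 /\ t2 < T /\
        {ae @lebesgue_measure R, forall t, `]0, t1[%classic t -> uh t = 0} /\
        {ae @lebesgue_measure R, forall t, `]t1, t2[%classic t -> uh t = u1} /\
        {ae @lebesgue_measure R, forall t, `]t2, T[%classic t -> uh t = 0}).
Proof.
have c0 : 0 < N%:R * sigma ^+ 2 by rewrite mulr_gt0 ?ltr0n ?exprn_gt0.
have u1_small : beta * u1 ^+ 2 < alpha * (N%:R * sigma ^+ 2).
  have a0 : 0 <= alpha * N%:R * sigma ^+ 2 / beta.
    by rewrite divr_ge0 ?ltW// -mulrA mulr_gt0.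
  have : u1 ^+ 2 < Num.sqrt (alpha * N%:R * sigma ^+ 2 / beta) ^+ 2.
    by rewrite ltrXn2r ?nnegrE ?sqrtr_ge0 ?ltW.
  by rewrite sqr_sqrtr// ltr_pdivlMr// mulrC mulrA.
have [u [x [cu uhu xu uopt]]] :=
  optimal_bounded_representative T alpha beta sigma u1 R0 N hT hu1 uh hopt.
have [bu ub] := cu; have [p pu] := adjoint_exists T alpha u bu.
have bb := bang_bang_ae T alpha beta _ u1 R0 hT u x p cu xu pu uopt.
have bx := prim_bmf _ _ _ xu.2; have bp := prim_bmf _ _ _ pu.2.
(* The switching argument needs the bang-bang rule at every point. [w] enforces it off the level
   [p * x = beta], keeps [u] on that level, and agrees with [u] almost everywhere; hence [x] and [p]
   also belong to [w]. *)
pose w t := if 0 < p t * x t - beta then u1 else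
  if 0 < beta - p t * x t then 0 else u t.
have bw : bmf T w by apply: bmf_if; [|apply: bmf_if|]; bmf_tac.
have uw : {ae @lebesgue_measure R, forall t, `[0, T]%classic t -> u t = w t}.
  apply: lebesgue_aeS bb => t h /h [h1 h2]; rewrite /w !subr_gt0.
  by case: ltrgtP h1 h2 => // _ h1 h2; [exact: h1|exact: h2].
have w_on t : beta < p t * x t -> w t = u1 by rewrite /w subr_gt0 => ->.
have w_off t : p t * x t < beta -> w t = 0.
  by move=> h; rewrite /w !subr_gt0 h ltNge ltW.
have cw : control T u1 w.
  split=> // t /ub; rewrite /w; case: ifP => _; [|case: ifP => _ //]; lra.
have pxw : prim T x (fun t => N%:R * sigma ^+ 2 - w t * x t).
  apply: prim_ae xu.2 _ _; first by bmf_tac.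
  by apply: lebesgue_aeS uw => t h /h ->.
have pw : adjoint T alpha w p.
  split; first exact: pu.1.
  apply: prim_ae pu.2 _ _; first by bmf_tac.
  by apply: lebesgue_aeS uw => t h /h ->.
have uhw : {ae @lebesgue_measure R, forall t, `[0, T]%classic t -> uh t = w t}.
  by apply: lebesgue_aeS2 uhu uw => t h1 h2 tT; rewrite h1// h2.
have ae_on (a b k : R) : 0 <= a -> b <= T -> (forall t, a < t < b -> w t = k) ->
    {ae @lebesgue_measure R, forall t, `]a, b[%classic t -> uh t = k}.
  move=> a0 bT wk; apply: lebesgue_aeS uhw => t h /=; rewrite in_itv/= => tab.
  rewrite h ?wk//= in_itv/=; case/andP: tab => at_ tb.
  by rewrite (le_trans a0) ?ltW// (lt_le_trans tb).
have [off|[t1 [t2 [t12 t2T on off]]]] := switching_shape T alpha beta _ u1 w x p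
  hT halpha hbeta c0 u1_small cw pxw pw (fun t _ => w_off t).
  left; apply: ae_on => // t /andP[t0 tT]; apply/w_off/off; exact/andP/(conj (ltW t0) (ltW tT)).
have [t10 t1t2] := andP t12; have t20 := le_trans t10 t1t2.
have woff t : 0 <= t <= T -> t < t1 \/ t2 < t -> w t = 0.
  by move=> tT ht; apply/w_off/off.
have ae_late : {ae @lebesgue_measure R, forall t, `]t2, T[%classic t -> uh t = 0}.
  apply: ae_on => // t /andP[t2t tT]; apply: woff; last by right.
  by rewrite (le_trans t20) ltW.
have ae_mid : {ae @lebesgue_measure R, forall t, `]t1, t2[%classic t -> uh t = u1}.
  by apply: ae_on => [||t ht]//; [exact: ltW|apply/w_on/on].
have ae_early : {ae @lebesgue_measure R, forall t, `]0, t1[%classic t -> uh t = 0}.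
  apply: ae_on => [||t /andP[t0 tt1]]//; first by rewrite (le_trans t1t2)// ltW.
  apply: woff; last by left.
  by rewrite ltW//= (le_trans (ltW tt1))// (le_trans t1t2)// ltW.
(* If [t1 = t2], then [w] vanishes on [0, T] except possibly at that one point, so the first form
   holds. *)
have [t1E|t1N] := eqVneq t1 t2.
  left; apply: lebesgue_aeS2 uhw (lebesgue_ae_neq _ t1) => t h tN /=.
  rewrite in_itv/= => /andP[t0 tT].
  have tT' : 0 <= t <= T by rewrite !ltW.
  rewrite h//=; apply: woff => //.
  by case: (ltgtP t t1) tN => //; rewrite t1E; [left|right].
have t1lt : t1 < t2 by rewrite lt_neqAle t1N.
(* If [t1 = 0], the initial off phase is empty and the only switching is at [t2]. *)
right; have [t1z|t1p] := eqVneq t1 0.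
  rewrite t1z in ae_mid t1lt.
  by left; exists t2; split; first by rewrite t1lt.
right; exists t1, t2; split; last by [].
by rewrite lt_neqAle eq_sym t1p t10.
Qed.
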